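(* Let $\Omega\subseteq\mathbb{R}^n$ be nonempty and closed and let $K\subseteq\mathbb{R}^m$ be a closed, convex, pointed, solid cone. Consider the metric space $(\mathcal{F}(\Omega),d)$, where $$\mathcal{F}(\Omega):=\{F:\mathbb{R}^n\rightrightarrows\mathbb{R}^m \mid \operatorname{dom}F=\Omega,\ F(\Omega)\text{ is bounded},\ F(x)\text{ is compact for all }x\in\Omega\}$$ and $d(F_1,F_2):=\sup_{x\in\Omega}d_H(F_1(x),F_2(x))$. Let $$\mathcal{V}(\Omega):=\{F\in\mathcal{F}(\Omega)\mid (\mathcal{SP})\text{ (with objective mapping }F)\text{ satisfies (wFDVP)}\}.$$ Then $\mathcal{V}(\Omega)$ is dense in $\mathcal{F}(\Omega)$.
   Context: $\mathbb{N}=\{1,2,\ldots\}$ and $[p]=\{1,\ldots,p\}$. For a set-valued mapping $F:\mathbb{R}^n\rightrightarrows\mathbb{R}^m$, $\operatorname{dom}F:=\{x: F(x)\neq\emptyset\}$ and $F(\Omega):=\bigcup_{x\in\Omega}F(x)$. A cone $K$ is pointed if $K\cap(-K)=\{0\}$ and solid if $\operatorname{int}K\ne\emptyset$. With $\mathbb{B}$ the Euclidean unit ball of $\mathbb{R}^m$, the Hausdorff distance of nonempty compact $A,B\subseteq\mathbb{R}^m$ is $d_H(A,B):=\inf\{\varepsilon\ge0: A\subseteq B+\varepsilon\mathbb{B},\ B\subseteq A+\varepsilon\mathbb{B}\}$. Set optimization problem $(\mathcal{SP})$: minimize $F(x)$ over $x\in\Omega$ with respect to the lower set less relation. A point $\bar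 x\in\Omega$ is a weakly minimal solution of $(\mathcal{SP})$, written $\bar x\in\operatorname{wargmin}(\mathcal{SP})$, if there is no $x\in\Omega$ with $F(\bar x)\subseteq F(x)+\operatorname{int}K$. Multiobjective problem $(\mathcal{VP}_p)$, $p\in\mathbb{N}$: minimize $(y^1,\ldots,y^p)\in\mathbb{R}^{mp}$ with respect to the cone $K^p=\prod_{i=1}^pK$ over all feasible $(x,y^1,\ldots,y^p)$, i.e. $x\in\Omega$ and $y^i\in F(x)$ for all $i\in[p]$. A feasible $(\bar x,\bar y^1,\ldots,\bar y^p)$ is a weakly minimal solution if there is no feasible $(x,y^1,\ldots,y^p)$ with $\bar y^i-y^i\in\operatorname{int}K$ for all $i\in[p]$. The set $\operatorname{wargmin}_x(\mathcal{VP}_p)$ is the projection onto the $x$-component in $\mathbb{R}^n$ of the set of weakly minimal solutions of $(\mathcal{VP}_p)$. $(\mathcal{SP})$ satisfies the weakly minimal finite dimensional vectorization property (wFDVP) if there exists $p\in\mathbb{N}$ with $\operatorname{wargmin}_x(\mathcal{VP}_p)=\operatorname{wargmin}(\mathcal{SP})$. *)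

(* Defs.v *)
From HB Require Import structures.
From mathcomp Require Import all_boot all_order all_algebra.
From mathcomp Require Import all_classical all_reals all_analysis.
From mathcomp Require Import ring lra.

Set Implicit Arguments.
Unset Strict Implicit.
Unset Printing Implicit Defensive.

Import Order.TTheory GRing.Theory Num.Theory.
Import numFieldNormedType.Exports.

Local Open Scope classical_set_scope.
Local Open Scope ring_scope.

Section euclidean.
Context {R : realType} {m : nat}.
Implicit Types (x y : 'rV[R]_m) (A B C : set 'rV[R]_m).

(* The library norm on row vectors is the maximum norm, not the Euclidean one. *)
Definition enorm x : R := Num.sqrt (\sum_i x ord0 i ^+ 2).

Definition unit_ball : set 'rV[R]_m := [set x | enorm x <= 1].

Definition msum A B : set 'rV[R]_m := [set a + b | a in A & b in B].

Definition mscale (e : R) A : set 'rV[R]_m := [set e *: a | a in A].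

(* The infimum is over a nonempty set as soon as A and B are nonempty and
   bounded; otherwise inf takes a default value. *)
Definition hausdorff_dist A B : R :=
  inf [set e | [/\ 0 <= e, A `<=` msum B (mscale e unit_ball)
                          & B `<=` msum A (mscale e unit_ball)]].

Lemma sqr_sum_ge0 x : 0 <= \sum_i x ord0 i ^+ 2.
Proof. by apply: sumr_ge0 => i _; exact: sqr_ge0. Qed.

Lemma enorm_ge0 x : 0 <= enorm x.
Proof. exact: sqrtr_ge0. Qed.

Lemma enorm_sqr x : enorm x ^+ 2 = \sum_i x ord0 i ^+ 2.
Proof. by rewrite sqr_sqrtr// sqr_sum_ge0. Qed.

Lemma enormN x : enorm (- x) = enorm x.
Proof. by congr Num.sqrt; apply: eq_bigr => i _; rewrite mxE sqrrN. Qed.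

Lemma enorm0 : enorm 0 = 0.
Proof.
by rewrite /enorm big1 ?sqrtr0// => i _; rewrite mxE expr0n.
Qed.

Lemma enormZ (e : R) x : enorm (e *: x) = `|e| * enorm x.
Proof.
rewrite /enorm -sqrtr_sqr -sqrtrM ?sqr_ge0// mulr_sumr.
by congr Num.sqrt; apply: eq_bigr => i _; rewrite mxE exprMn.
Qed.

Lemma le_enorm x i : `|x ord0 i| <= enorm x.
Proof.
rewrite -sqrtr_sqr ler_wsqrtr// (bigD1 i)//= lerDl.
by apply: sumr_ge0 => j _; exact: sqr_ge0.
Qed.

Lemma enorm_eq0 x : enorm x = 0 -> x = 0.
Proof.
move=> x0; apply/rowP => i; rewrite mxE; apply/eqP.
by rewrite -normr_le0 -x0 le_enorm.
Qed.

Lemma cauchy_schwarz x y :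
  \sum_i x ord0 i * y ord0 i <= enorm x * enorm y.
Proof.
have [/enorm_eq0->|x0] := eqVneq (enorm x) 0.
  by rewrite enorm0 mul0r big1// => i _; rewrite mxE mul0r.
have [/enorm_eq0->|y0] := eqVneq (enorm y) 0.
  by rewrite enorm0 mulr0 big1// => i _; rewrite mxE mulr0.
have xy0 : 0 < enorm x * enorm y.
  by rewrite mulr_gt0// lt_neqAle eq_sym enorm_ge0 ?x0 ?y0.
rewrite -subr_ge0 -(pmulr_rge0 _ (mulr_gt0 (ltr0n _ 2) xy0)).
have -> : 2 * (enorm x * enorm y) *
    (enorm x * enorm y - \sum_i x ord0 i * y ord0 i) =
    \sum_i (enorm y * x ord0 i - enorm x * y ord0 i) ^+ 2.
  transitivity (\sum_i (enorm y ^+ 2 * x ord0 i ^+ 2 +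
      enorm x ^+ 2 * y ord0 i ^+ 2 -
      2 * (enorm x * enorm y) * (x ord0 i * y ord0 i))).
    rewrite sumrB big_split/= -!mulr_sumr -!enorm_sqr; ring.
  by apply: eq_bigr => i _; ring.
by apply: sumr_ge0 => i _; exact: sqr_ge0.
Qed.

Lemma enormD x y : enorm (x + y) <= enorm x + enorm y.
Proof.
rewrite -(@ler_pXn2r _ 2)// ?nnegrE ?addr_ge0 ?enorm_ge0//.
rewrite enorm_sqr (eq_bigr (fun i => x ord0 i ^+ 2 + y ord0 i ^+ 2 +
  2 * (x ord0 i * y ord0 i))); last by move=> i _; rewrite mxE; ring.
rewrite !big_split/= -mulr_sumr -!enorm_sqr.
have := cauchy_schwarz x y; nra.
Qed.

Lemma mx_norm_le_enorm x : `|x| <= enorm x.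
Proof.
rewrite [leLHS]/Num.norm/= mx_normrE; apply/bigmax_leP; split=> [|[i j] _ /=].
  exact: enorm_ge0.
by rewrite (ord1 i) le_enorm.
Qed.

Lemma enorm_le_mx_norm (M : R) x : `|x| <= M ->
  enorm x <= Num.sqrt (\sum_(i < m) M ^+ 2).
Proof.
move=> xM; rewrite ler_wsqrtr//; apply: ler_sum => i _.
rewrite -[leLHS]real_normK ?num_real// ler_pXn2r ?nnegrE// ?(le_trans (normr_ge0 _) xM)//.
apply: le_trans xM; rewrite [leRHS]/Num.norm/= mx_normrE.
by apply/bigmax_geP; right; exists (ord0, i).
Qed.

Lemma sub_msum_ballP A B (e : R) : 0 <= e ->
  A `<=` msum B (mscale e unit_ball) <->
  forall a, A a -> exists2 b, B b & enorm (a - b) <= e.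
Proof.
move=> e0; split=> AB a /AB.
  move=> [b Bb] [_ [u u1 <-] <-]; exists b => //.
  rewrite addrC addKr enormZ ger0_norm//.
  by rewrite -[leRHS]mulr1 ler_wpM2l.
move=> [b Bb abe]; exists b => //.
exists (a - b); last by rewrite addrC subrK.
have [E|eN0] := eqVneq e 0.
  have /enorm_eq0-> : enorm (a - b) = 0.
    by apply/le_anti; rewrite enorm_ge0 -E abe.
  by exists 0; rewrite ?scaler0// /unit_ball/= enorm0.
exists (e^-1 *: (a - b)); last by rewrite scalerA mulfV// scale1r.
by rewrite /unit_ball/= enormZ ger0_norm ?invr_ge0// mulrC ler_pdivrMr
  ?mul1r// lt_neqAle eq_sym eN0.
Qed.

Let hset A B := [set e : R | [/\ 0 <= e, A `<=` msum B (mscale e unit_ball)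
                          & B `<=` msum A (mscale e unit_ball)]].

Let hset_lb A B : lbound (hset A B) 0.
Proof. by move=> e []. Qed.

Let hset_has_lb A B : has_lbound (hset A B).
Proof. by exists 0; exact: hset_lb. Qed.

Let hset_bounded A B (M : R) : A !=set0 -> B !=set0 ->
  (forall x, A x -> enorm x <= M) -> (forall x, B x -> enorm x <= M) ->
  hset A B (M + M).
Proof.
move=> [a Aa] [b Bb] AM BM.
have M0 : 0 <= M + M by rewrite addr_ge0// (le_trans (enorm_ge0 a)) ?AM.
have xyM x y : enorm x <= M -> enorm y <= M -> enorm (x - y) <= M + M.
  by move=> xM yM; rewrite (le_trans (enormD _ _))// enormN lerD.
split=> //; apply/(sub_msum_ballP _ _ M0) => x Ax.
- by exists b => //; apply: xyM; [exact: AM|exact: BM].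
- by exists a => //; apply: xyM; [exact: BM|exact: AM].
Qed.

Lemma hausdorff_dist_le A B (M : R) : A !=set0 -> B !=set0 ->
  (forall x, A x -> enorm x <= M) -> (forall x, B x -> enorm x <= M) ->
  hausdorff_dist A B <= M + M.
Proof. by move=> *; apply: (ge_inf (hset_has_lb _ _)); exact: hset_bounded. Qed.

Lemma hausdorff_dist_ge0 A B : 0 <= hausdorff_dist A B.
Proof.
rewrite /hausdorff_dist -/(hset A B).
have [S0|/nonemptyPn->] := pselect (hset A B !=set0); last by rewrite inf0.
by apply: lb_le_inf => //; exact: hset_lb.
Qed.

Lemma hausdorff_distC A B : hausdorff_dist A B = hausdorff_dist B A.
Proof.
by congr inf; apply/seteqP; split=> e [].
Qed.

Lemma hausdorff_distxx A : hausdorff_dist A A = 0.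
Proof.
apply/le_anti; rewrite hausdorff_dist_ge0 andbT.
apply: (ge_inf (hset_has_lb _ _)).
by split=> //; apply/(sub_msum_ballP _ _ (lexx 0)) => a Aa; exists a;
  rewrite ?subrr ?enorm0.
Qed.

Let ebounded A := exists M, forall x, A x -> enorm x <= M.

Let hset_nonempty A B : A !=set0 -> B !=set0 -> ebounded A -> ebounded B ->
  hset A B !=set0.
Proof.
move=> A0 B0 [M AM] [N BN]; exists (Num.max M N + Num.max M N).
by apply: hset_bounded => // x ?; rewrite le_max; apply/orP;
  [left; exact: AM|right; exact: BN].
Qed.

Lemma hausdorff_dist_triangle A B C :
  A !=set0 -> B !=set0 -> C !=set0 ->
  ebounded A -> ebounded B -> ebounded C ->
  hausdorff_dist A C <= hausdorff_dist A B + hausdorff_dist B C.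
Proof.
move=> A0 B0 C0 Ab Bb Cb; rewrite -lerBlDr.
apply: lb_le_inf; first exact: hset_nonempty.
move=> e [e0 AB BA]; rewrite lerBlDr addrC -lerBlDr.
apply: lb_le_inf; first exact: hset_nonempty.
move=> f [f0 BC CB]; rewrite lerBlDr; apply: (ge_inf (hset_has_lb _ _)).
have ef0 : 0 <= f + e by rewrite addr_ge0.
have tri (x y z : 'rV[R]_m) (r s : R) :
    enorm (x - y) <= r -> enorm (y - z) <= s -> enorm (x - z) <= s + r.
  move=> xy yz; have -> : x - z = (x - y) + (y - z) by rewrite addrA subrK.
  by rewrite (le_trans (enormD _ _))// addrC lerD.
split=> //; apply/(sub_msum_ballP _ _ ef0) => x.
- move=> /((sub_msum_ballP A B e0).1 AB)[y].
  move=> /((sub_msum_ballP B C f0).1 BC)[z Cz yz] xy; exists z => //.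
  exact: (tri _ _ _ _ _ xy yz).
- move=> /((sub_msum_ballP C B f0).1 CB)[y].
  move=> /((sub_msum_ballP B A e0).1 BA)[z Cz yz] xy; exists z => //.
  by rewrite (addrC f); exact: (tri _ _ _ _ _ xy yz).
Qed.

Let closed_limit A B : closed B ->
  (forall e, 0 < e -> forall a, A a -> exists2 b, B b & enorm (a - b) < e) ->
  A `<=` B.
Proof.
move=> cB AB a Aa; apply: cB => N /nbhs_ballP[e /= e0 eN].
have [b Bb abe] := AB _ e0 _ Aa; exists b; split=> //; apply: eN.
by rewrite mx_norm_ball /ball_/= (le_lt_trans (mx_norm_le_enorm _)).
Qed.

Lemma hausdorff_dist_eq0 A B :
  A !=set0 -> B !=set0 -> closed A -> closed B -> ebounded A -> ebounded B ->
  hausdorff_dist A B = 0 -> A = B.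
Proof.
move=> A0 B0 cA cB Ab Bb AB0; have AB := hset_nonempty A0 B0 Ab Bb.
by apply/seteqP; split; apply: closed_limit => // e e0;
  have [f [f0 /sub_msum_ballP AB1 /sub_msum_ballP AB2]] :=
    inf_adherent e0 (conj AB (hset_has_lb A B));
  rewrite [inf _]AB0 add0r => fe a; [move/(AB1 f0)|move/(AB2 f0)];
  move=> [b Bb' abf]; exists b => //; exact: le_lt_trans fe.
Qed.

End euclidean.

Section cones.
Context {R : realType} {m : nat}.
Implicit Type K : set 'rV[R]_m.

Definition cone K := forall (t : R) x, 0 <= t -> K x -> K (t *: x).

Definition pointed_cone K := K `&` [set - x | x in K] = [set 0].

Definition solid K := K° !=set0.

End cones.

Section problems.
Context {R : realType} {n m : nat}.
Variables (Omega : set 'rV[R]_n) (K : set 'rV[R]_m).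
Variable F : 'rV[R]_n -> set 'rV[R]_m.

Definition wargmin_SP : set 'rV[R]_n :=
  [set x0 | Omega x0 /\ ~ exists2 x, Omega x & F x0 `<=` msum (F x) K°].

Section vectorization.
Variable p : nat.

Definition feasible_VP (x : 'rV[R]_n) (y : 'I_p -> 'rV[R]_m) :=
  Omega x /\ forall i, F x (y i).

Definition weakly_minimal_VP (x0 : 'rV[R]_n) (y0 : 'I_p -> 'rV[R]_m) :=
  feasible_VP x0 y0 /\
  ~ exists x y, feasible_VP x y /\ forall i, K° (y0 i - y i).

Definition wargminx_VP : set 'rV[R]_n :=
  [set x0 | exists y0, weakly_minimal_VP x0 y0].

End vectorization.

Definition wFDVP := exists2 p : nat, (0 < p)%N & wargminx_VP p = wargmin_SP.

End problems.

Section space_of_mappings.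
Context {R : realType} {n m : nat}.
Implicit Type Omega : set 'rV[R]_n.

Definition svdom (F : 'rV[R]_n -> set 'rV[R]_m) : set 'rV[R]_n :=
  [set x | F x !=set0].

(* Boundedness does not depend on the choice of the norm of 'rV[R]_m, so the
   library notion for the maximum norm is used. *)
Definition admissible_map Omega : set ('rV[R]_n -> set 'rV[R]_m) :=
  [set F | [/\ svdom F = Omega, bounded_set (\bigcup_(x in Omega) F x)
             & forall x, Omega x -> compact (F x)]].

Definition Fspace Omega : Type := {F | F \in admissible_map Omega}.

HB.instance Definition _ Omega := Choice.on (Fspace Omega).

Definition Fspace_fun Omega (F : Fspace Omega) : 'rV[R]_n -> set 'rV[R]_m :=
  \val F.

Coercion Fspace_fun : Fspace >-> Funclass.

(* The supremum is over a set bounded above, by Fspace_dist_has_ub below. *)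
Definition Fspace_dist Omega (F G : Fspace Omega) : R :=
  sup [set hausdorff_dist (F x) (G x) | x in Omega].

Section metric.
Variable Omega : set 'rV[R]_n.
Implicit Types F G J : Fspace Omega.

Lemma FspaceP F : admissible_map Omega F.
Proof. by have := valP F; rewrite inE. Qed.

Lemma Fspace_nonempty F x : Omega x -> F x !=set0.
Proof. by have [/seteqP[_ OF] _ _] := FspaceP F; exact: OF. Qed.

Lemma Fspace_empty F x : ~ Omega x -> F x = set0.
Proof.
have [/seteqP[domF _] _ _] := FspaceP F => nOx.
by apply/nonemptyPn => Fx0; apply: nOx; exact: domF.
Qed.

Lemma Fspace_closed F x : Omega x -> closed (F x).
Proof.
move=> Ox; have [_ _ /(_ _ Ox)] := FspaceP F.
by apply: compact_closed; exact: norm_hausdorff.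
Qed.

Lemma Fspace_bounded F :
  exists M, forall x, Omega x -> forall y, F x y -> enorm y <= M.
Proof.
have [_ [M [_ FM]] _] := FspaceP F.
exists (Num.sqrt (\sum_(i < m) (M + 1) ^+ 2)) => x Ox y Fxy.
by apply: enorm_le_mx_norm; apply: (FM (M + 1)); [rewrite ltrDl|exists x].
Qed.

Let ebounded F x : Omega x -> exists M, forall y, F x y -> enorm y <= M.
Proof. by move=> Ox; have [M FM] := Fspace_bounded F; exists M; exact: FM. Qed.

Lemma Fspace_dist_has_ub F G :
  has_ubound [set hausdorff_dist (F x) (G x) | x in Omega].
Proof.
have [M FM] := Fspace_bounded F; have [N GN] := Fspace_bounded G.
exists (Num.max M N + Num.max M N) => _ [x Ox <-].
apply: hausdorff_dist_le; try exact: Fspace_nonempty.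
- by move=> y /(FM _ Ox) yM; rewrite le_max yM.
- by move=> y /(GN _ Ox) yM; rewrite le_max yM orbT.
Qed.

Lemma hausdorff_le_Fspace_dist F G x : Omega x ->
  hausdorff_dist (F x) (G x) <= Fspace_dist F G.
Proof.
move=> Ox; apply: sup_upper_bound; last by exists x.
by split; [exists (hausdorff_dist (F x) (G x)), x|exact: Fspace_dist_has_ub].
Qed.

Lemma Fspace_dist_le F G (e : R) : 0 <= e ->
  (forall x, Omega x -> hausdorff_dist (F x) (G x) <= e) ->
  Fspace_dist F G <= e.
Proof.
move=> e0 FGe; rewrite /Fspace_dist.
have [S0|/nonemptyPn->] :=
    pselect ([set hausdorff_dist (F x) (G x) | x in Omega] !=set0).
  by apply: ge_sup => // _ [x Ox <-]; exact: FGe.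
by rewrite sup0.
Qed.

Lemma Fspace_dist_ge0 F G : 0 <= Fspace_dist F G.
Proof.
rewrite /Fspace_dist.
have [[_ [x Ox _]]|/nonemptyPn->] :=
    pselect ([set hausdorff_dist (F x) (G x) | x in Omega] !=set0).
  exact: le_trans (hausdorff_dist_ge0 _ _) (hausdorff_le_Fspace_dist F G Ox).
by rewrite sup0.
Qed.

Lemma Fspace_distxx F : Fspace_dist F F = 0.
Proof.
apply/le_anti; rewrite Fspace_dist_ge0 andbT; apply: Fspace_dist_le => // x _.
by rewrite hausdorff_distxx.
Qed.

Lemma Fspace_distC F G : Fspace_dist F G = Fspace_dist G F.
Proof.
by congr sup; apply: eq_imagel => x _; rewrite hausdorff_distC.
Qed.

Lemma Fspace_dist_triangle G F J :
  Fspace_dist F J <= Fspace_dist F G + Fspace_dist G J.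
Proof.
apply: Fspace_dist_le => [|x Ox]; first by rewrite addr_ge0 ?Fspace_dist_ge0.
apply: (@le_trans _ _
  (hausdorff_dist (F x) (G x) + hausdorff_dist (G x) (J x))).
  apply: hausdorff_dist_triangle; by [exact: Fspace_nonempty|exact: ebounded].
by rewrite lerD ?hausdorff_le_Fspace_dist.
Qed.

Lemma Fspace_dist_eq0 F G : Fspace_dist F G = 0 -> F = G.
Proof.
move=> FG0; apply/val_inj/funext => x; rewrite -/(Fspace_fun F) -/(Fspace_fun G).
have [Ox|nOx] := pselect (Omega x); last by rewrite !Fspace_empty.
apply: hausdorff_dist_eq0; try by [exact: Fspace_nonempty|exact: ebounded].
- exact: Fspace_closed.
- exact: Fspace_closed.
apply/le_anti; rewrite hausdorff_dist_ge0 andbT -FG0.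
exact: hausdorff_le_Fspace_dist.
Qed.

HB.instance Definition _ := isMetric.Build R (Fspace Omega)
  Fspace_distxx Fspace_dist_eq0 Fspace_distC Fspace_dist_triangle.

End metric.

Definition Vspace Omega (K : set 'rV[R]_m) : set (Fspace Omega) :=
  [set F | wFDVP Omega K F].

End space_of_mappings.

Arguments Vspace {R n m} Omega K.

(* Main.v *)
Require Import Defs.
From HB Require Import structures.
From mathcomp Require Import all_boot all_order all_algebra.
From mathcomp Require Import finmap.
From mathcomp Require Import all_classical all_reals all_analysis.

Import Order.TTheory GRing.Theory Num.Theory.
Import numFieldNormedType.Exports.

Local Open Scope classical_set_scope.
Local Open Scope ring_scope.

(* If the values of F all lie in one finite set of fewer than p points, a point
   (y^1, ..., y^p) can list all of F(x), and componentwise domination of such a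
   list is domination of F(x) in the lower set less relation; so (wFDVP) holds.
   Rounding each value of an arbitrary F to a finite net of the bounded set
   F(Omega) moves it by an arbitrarily small Hausdorff distance. *)

(** Squaring reduces this to [m < (m+1)^2], which is strict even for [m = 0]. *)
Lemma enorm_lt_of_mx_norm {R : realType} {m : nat} (e : R) (v : 'rV[R]_m) :
  0 < e -> `|v| <= e / m.+1%:R -> enorm v < e.
Proof.
move=> e0 /enorm_le_mx_norm/le_lt_trans; apply.
rewrite -[ltRHS]ger0_norm ?ltW// -sqrtr_sqr ltr_sqrt ?exprn_gt0//.
rewrite sumr_const card_ord expr_div_n -[_ *+ m]mulr_natr -mulrA gtr_pMr ?exprn_gt0//.
by rewrite mulrC ltr_pdivrMr ?exprn_gt0// mul1r -natrX ltr_nat expnS expn1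
  mulSn ltn_addr.
Qed.

Lemma bounded_finite_net {R : realType} {m : nat} (A : set 'rV[R]_m) (e : R) :
  0 < e -> bounded_set A ->
  exists (D : {fset 'rV[R]_m}) (r : 'rV[R]_m -> 'rV[R]_m),
    forall y, A y -> r y \in D /\ `|y - r y| < e.
Proof.
move=> e0 [M [_ AM]].
(* Boundedness only provides bounds strictly above [M], hence [M + 1]. This closed ball is compact,
   while [A] need not be closed. *)
pose B : set 'rV[R]_m := [set y | `|y| <= M + 1].
have : compact B.
  apply: bounded_closed_compact.
    by exists (M + 1); split=> [|x Mx y /le_trans]; [exact: num_real|
      apply; exact: ltW].
  apply: (@closed_comp _ _ (fun y : 'rV[R]_m => `|y|) [set x | x <= M + 1]).
    by move=> y _; exact: norm_continuous.
  exact: closed_le.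
rewrite compact_cover => /(_ _ setT (fun c => ball c e)) [|y _|D _ BD].
- by move=> c _; exact: ball_open.
- by exists y => //; exact: ballxx.
(* The implication sits under the existential so that [choice] yields a total [r], arbitrary off
   [A]. *)
have near_D y : exists c, A y -> c \in D /\ `|y - c| < e.
  have [Ay|nAy] := pselect (A y); last by exists 0.
  have [|c Dc cy] := BD y; first by apply: (AM (M + 1)) => //; rewrite ltrDl.
  exists c => _; split=> //.
  by move: cy; rewrite mx_norm_ball /ball_/= distrC.
by have [r rP] := choice near_D; exists D, r.
Qed.

Lemma wFDVP_finite_values {R : realType} {n m : nat} (Omega : set 'rV[R]_n)
    (K : set 'rV[R]_m) (F : 'rV[R]_n -> set 'rV[R]_m) (D : {fset 'rV[R]_m}) :
  (forall x, Omega x -> F x `<=` [set` D]) -> wFDVP Omega K F.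
Proof.
move=> FD; exists (size D).+1 => //; apply/seteqP; split=> [x0|x0 []] /=.
  move=> [y0 [[Ox0 Fy0] nondom]]; split=> // -[x Ox Fx0x]; apply: nondom.
  have dom i : exists y, F x y /\ K° (y0 i - y).
    by have [y Fy [k Kk <-]] := Fx0x _ (Fy0 i); exists y; rewrite addrC addKr.
  by have [y yP] := choice dom; exists x, y; split=> [|i];
    [split=> // i|]; have [] := yP i.
move=> Ox0 nondom.
(* An empty [F x0] would be included in every set, so [x0] would dominate itself. *)
have [z Fz] : F x0 !=set0.
  apply/set0P/negP => /eqP F0; apply: nondom; exists x0 => //.
  by rewrite F0; exact: sub0set.
(* Entries of [D] outside [F x0] are replaced by the filler [z], so the list is feasible and still
   contains all of [F x0]. *)
pose y0 (i : 'I_(size D).+1) :=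
  if `[< F x0 (nth z D i) >] then nth z D i else z.
exists y0; split; first by split=> // i; rewrite /y0; case: asboolP.
move=> [x [y [[Ox Fy] dom]]]; apply: nondom; exists x => // a Fa.
have aD : a \in D := FD _ Ox0 _ Fa.
have aS : (index a D < (size D).+1)%N by rewrite ltnS index_size.
have y0a : y0 (Ordinal aS) = a by rewrite /y0/= nth_index//; case: asboolP.
exists (y (Ordinal aS)) => //; exists (a - y (Ordinal aS)).
  by have := dom (Ordinal aS); rewrite y0a.
by rewrite addrC subrK.
Qed.

Lemma hausdorff_dist_image_le {R : realType} {m : nat} (A : set 'rV[R]_m)
    (r : 'rV[R]_m -> 'rV[R]_m) (e : R) : 0 <= e ->
  (forall y, A y -> enorm (y - r y) <= e) ->
  hausdorff_dist A [set r y | y in A] <= e.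
Proof.
move=> e0 rA; apply: ge_inf; first by exists 0 => ? [].
split=> //; apply/(sub_msum_ballP _ _ e0).
  by move=> y Ay; exists (r y); [exists y|exact: rA].
move=> _ [y Ay <-].
by exists y => //; rewrite -enormN opprB rA.
Qed.

Theorem theorem4p2 (R : realType) (n m : nat)
    (Omega : set 'rV[R]_n) (K : set 'rV[R]_m)
    (Omega_nonempty : Omega !=set0) (Omega_closed : closed Omega)
    (K_closed : closed K)
    (K_convex : convex_set (K : set (convex_lmodType 'rV[R]_m)))
    (K_cone : cone K) (K_pointed : pointed_cone K) (K_solid : solid K) :
  dense (Vspace Omega K).
Proof.
move=> O [F OF] openO; change (@Fspace R n m Omega) in F.
have [e /= e0 FeO] : nbhs_ball F O by apply/nbhs_ballP; exact: open_nbhs_nbhs.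
(* A supremum only inherits a weak bound; halving [e] restores strictness at the end. *)
have e20 : 0 < e / 2 by rewrite divr_gt0.
have [FO Fbnd _] := FspaceP F.
(* The net is built for the maximum norm; the extra factor [1/(m+1)] makes it an [e / 2]-net for the
   Euclidean norm. *)
have [D [r rP]] := bounded_finite_net _ _ (divr_gt0 e20 (ltr0Sn R m)) Fbnd.
pose G x := [set r y | y in F x].
have GD x : Omega x -> G x `<=` [set` D].
  by move=> Ox _ [y Fy <-]; have [] := rP y; first by exists x.
(* Taking images under [r] preserves emptiness, hence the domain; compactness and boundedness come
   from the finiteness of [D]. *)
have G_adm : G \in admissible_map Omega.
  rewrite inE; split.
  - rewrite -FO; apply/seteqP; split=> x; first by move=> [_ [y Fy _]]; exists y.
    by move=> [y Fy]; exists (r y), y.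
  - apply: compact_bounded; apply/finite_compact/(sub_finite_set _ (finite_fset D)).
    by move=> y [x Ox]; exact: GD.
  - move=> x Ox; apply: finite_compact.
    exact: sub_finite_set (GD x Ox) (finite_fset D).
pose G' : Fspace Omega := exist _ G G_adm.
exists G'; split; last exact: wFDVP_finite_values GD.
apply: FeO; apply: (@le_lt_trans _ _ (e / 2)).
  apply: Fspace_dist_le => [|x Ox]; first exact: ltW.
  apply: hausdorff_dist_image_le => [|y Fy]; first exact: ltW.
  have [|_ yr] := rP y; first by exists x.
  by apply/ltW/enorm_lt_of_mx_norm => //; exact: ltW.
by rewrite ltr_pdivrMr// ltr_pMr// ltr1n.
Qed.
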